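(* Let $G$ be a group, let $H_1,\dots,H_n$ ($n\ge1$) be subgroups of $G$, and let $2G$ be the double of $G$ along $H_1,\dots,H_n$. Then $G$ embeds naturally in $2G$, and for all $u,v\in G$, $u$ and $v$ are conjugate in $2G$ if and only if they are conjugate in $G$.
   Context: Double of a group: let $G'$ be an isomorphic copy of $G$, $\varphi:G\to G'$ an isomorphism, and $H_i'=\varphi(H_i)$. Consider the graph of groups with two vertices $s,s'$ and $n$ edges $\alpha_1,\dots,\alpha_n$, all with origin $s$ and end $s'$, with vertex groups $G_s=G$, $G_{s'}=G'$, and such that the edge $\alpha_i$ identifies the edge subgroup $H_i\subset G$ with $H_i'\subset G'$ via the restriction $\varphi|_{H_i}$. The double $2G$ of $G$ along $H_1,\dots,H_n$ is the fundamental group of this graph of groups; explicitly, taking $\alpha_1$ as maximal tree, $2G$ is the quotient of the free product $G*G'*F(t_2,\dots,t_n)$ by the relations $h=\varphi(h)$ for $h\in H_1$ and $h=t_i\varphi(h)t_i^{-1}$ for $h\in H_i$, $i=2,\dots,n$. The natural map $G\to 2G$ is the one induced by the inclusion of $G$ in this free product. *)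

(* Defs.v *)
From HB Require Import structures.
From mathcomp Require Import all_boot boolp.

Set Implicit Arguments.
Unset Strict Implicit.
Unset Printing Implicit Defensive.

Local Open Scope group_scope.
Local Open Scope quotient_scope.

(* The group <X | R> presented by the generators X and the relations R.  The  *)
(* letter (x, false) stands for the generator x and (x, true) for its inverse.*)

Definition word (X : Type) := seq (X * bool).

Inductive pres_eq (X : Type) (R : word X -> word X -> Prop) :
    word X -> word X -> Prop :=
| Pres_refl s : pres_eq R s s
| Pres_sym s t : pres_eq R s t -> pres_eq R t s
| Pres_trans s t u : pres_eq R s t -> pres_eq R t u -> pres_eq R s u
| Pres_cat s1 s2 t1 t2 :
    pres_eq R s1 s2 -> pres_eq R t1 t2 -> pres_eq R (s1 ++ t1) (s2 ++ t2)
| Pres_cancel x b : pres_eq R [:: (x, b); (x, ~~ b)] [::]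
| Pres_rel s t : R s t -> pres_eq R s t.

Section PresentedGroup.
Variables (X : choiceType) (R : word X -> word X -> Prop).

Definition pres_eqb (s t : word X) : bool := `[< pres_eq R s t >].

Lemma pres_eqb_refl : reflexive pres_eqb.
Proof. by move=> s; apply/asboolP; apply: Pres_refl. Qed.

Lemma pres_eqb_sym : symmetric pres_eqb.
Proof. by move=> s t; apply/asboolP/asboolP; apply: Pres_sym. Qed.

Lemma pres_eqb_trans : transitive pres_eqb.
Proof.
by move=> t s u /asboolP st /asboolP tu; apply/asboolP; apply: Pres_trans tu.
Qed.

Canonical pres_equiv := EquivRel pres_eqb
  pres_eqb_refl pres_eqb_sym pres_eqb_trans.

Definition presented := {eq_quot pres_equiv}.

HB.instance Definition _ := Choice.on presented.
HB.instance Definition _ := EqQuotient.on presented.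

Lemma presentedP (s t : word X) :
  \pi_presented s = \pi_presented t <-> pres_eq R s t.
Proof.
by split=> [/eqmodP/asboolP | st]; last by apply/eqmodP/asboolP.
Qed.

Definition word_inv (s : word X) : word X :=
  [seq (l.1, ~~ l.2) | l <- rev s].

Lemma word_inv_cat s t : word_inv (s ++ t) = word_inv t ++ word_inv s.
Proof. by rewrite /word_inv rev_cat map_cat. Qed.

Lemma word_invK : involutive word_inv.
Proof.
move=> s; rewrite /word_inv -map_rev revK -map_comp -[RHS]map_id.
by apply: eq_map => -[x b] /=; rewrite negbK.
Qed.

Lemma pres_eq_invr s : pres_eq R (s ++ word_inv s) [::].
Proof.
elim/last_ind: s => [|s [x b] IHs]; first exact: Pres_refl.
rewrite -cats1 word_inv_cat catA -(catA s).
apply: Pres_trans IHs; apply: Pres_cat; last exact: Pres_refl.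
rewrite -[X in pres_eq R _ X]cats0.
by apply: Pres_cat; [exact: Pres_refl | exact: Pres_cancel].
Qed.

Lemma pres_eq_invl s : pres_eq R (word_inv s ++ s) [::].
Proof. by rewrite -{2}(word_invK s); apply: pres_eq_invr. Qed.

Lemma pres_eq_inv s t : pres_eq R s t -> pres_eq R (word_inv s) (word_inv t).
Proof.
move=> st; apply: (@Pres_trans _ _ _ (word_inv s ++ (t ++ word_inv t))).
  rewrite -{1}[word_inv s]cats0; apply: Pres_cat; first exact: Pres_refl.
  exact/Pres_sym/pres_eq_invr.
rewrite catA -[X in pres_eq R _ X]cat0s; apply: Pres_cat; last exact: Pres_refl.
apply: Pres_trans (pres_eq_invl s); apply: Pres_cat; first exact: Pres_refl.
exact: Pres_sym.
Qed.

Definition pres_one : presented := \pi_presented [::].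
Definition pres_mul (x y : presented) : presented :=
  \pi_presented (repr x ++ repr y).
Definition pres_inv (x : presented) : presented :=
  \pi_presented (word_inv (repr x)).

Lemma repr_pi s : pres_eq R (repr (\pi_presented s)) s.
Proof. by apply/presentedP; rewrite reprK. Qed.

Lemma pres_mul_pi s t :
  pres_mul (\pi_presented s) (\pi_presented t) = \pi_presented (s ++ t).
Proof. by apply/presentedP; apply: Pres_cat; apply: repr_pi. Qed.

Lemma pres_inv_pi s :
  pres_inv (\pi_presented s) = \pi_presented (word_inv s).
Proof. exact/presentedP/pres_eq_inv/repr_pi. Qed.

Lemma pres_mulA : associative pres_mul.
Proof.
elim/quotW=> s; elim/quotW=> t; elim/quotW=> u.
by rewrite (pres_mul_pi t u) (pres_mul_pi s t) !pres_mul_pi catA.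
Qed.

Lemma pres_mul1 : left_id pres_one pres_mul.
Proof. by elim/quotW=> s; rewrite pres_mul_pi. Qed.

Lemma pres_mulr1 : right_id pres_one pres_mul.
Proof. by elim/quotW=> s; rewrite pres_mul_pi cats0. Qed.

Lemma pres_mulV : left_inverse pres_one pres_inv pres_mul.
Proof.
elim/quotW=> s; rewrite pres_inv_pi pres_mul_pi.
exact/presentedP/pres_eq_invl.
Qed.

Lemma pres_mulrV : right_inverse pres_one pres_inv pres_mul.
Proof.
elim/quotW=> s; rewrite pres_inv_pi pres_mul_pi.
exact/presentedP/pres_eq_invr.
Qed.

HB.instance Definition _ := isGroup.Build presented
  pres_mulA pres_mul1 pres_mulr1 pres_mulV pres_mulrV.

End PresentedGroup.

Section Double.
Variables (G G' : groupType) (phi : G -> G').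
Variables (n : nat) (H : 'I_n.+1 -> {pred G}).

Definition double_gen := (G + G' + 'I_n)%type.

Definition letG (x : G) : double_gen * bool := (inl (inl x), false).
Definition letG' (x : G') : double_gen * bool := (inl (inr x), false).
Definition letT (i : 'I_n) : double_gen * bool := (inr i, false).
Definition letTV (i : 'I_n) : double_gen * bool := (inr i, true).

(* The subgroups H_1, ..., H_(n+1) are indexed from 0: the edge of the        *)
(* maximal tree is the one of H ord0, and the stable letter t_i belongs to    *)
(* the edge of H (lift ord0 i).  The first two families of relations are the  *)
(* multiplication tables of G and G'; alone they present G * G' * F(t).       *)
Inductive double_rel : word double_gen -> word double_gen -> Prop :=
| Double_mulG x y : double_rel [:: letG x; letG y] [:: letG (x * y)]
| Double_mulG' x y : double_rel [:: letG' x; letG' y] [:: letG' (x * y)]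
| Double_tree h : h \in H ord0 -> double_rel [:: letG h] [:: letG' (phi h)]
| Double_edge i h : h \in H (lift ord0 i) ->
    double_rel [:: letG h] [:: letT i; letG' (phi h); letTV i].

Definition group_double := presented double_rel.
HB.instance Definition _ := Group.on group_double.

Definition to_double (x : G) : group_double := \pi_group_double [:: letG x].

Lemma to_doubleM : {morph to_double : x y / x * y}.
Proof.
move=> x y; rewrite /to_double [RHS]pres_mul_pi.
exact/presentedP/Pres_sym/Pres_rel/Double_mulG.
Qed.

HB.instance Definition _ := isMultiplicative.Build G group_double
  to_double to_doubleM.

End Double.

Definition conjugate (G : groupType) (x y : G) : Prop := exists z, x ^ z = y.

(* Main.v *)
From HB Require Import structures.
Require Import Defs.
From mathcomp Require Import all_boot.

(** The double retracts onto [G].  Send [G] to itself by the identity, [G'] to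
    [G] by the inverse of [phi], and every stable letter [t_i] to [1]: each
    edge relation becomes [h = h], so by the universal property of the
    presentation ([presented_lift]) this defines a homomorphism from the double
    to [G], and it is the identity on [G] ([double_retraction]).  A map with a
    left inverse is injective, and since homomorphisms preserve conjugacy,
    applying the retraction to a conjugation in the double yields one in [G];
    the converse holds because [to_double] is a homomorphism. *)

Set Implicit Arguments.
Unset Strict Implicit.
Unset Printing Implicit Defensive.

Local Open Scope group_scope.
Local Open Scope quotient_scope.

Section WordValue.
Variables (K : groupType) (X : Type) (f : X -> K).

Definition word_value (s : word X) : K :=
  foldr (fun l y => (if l.2 then (f l.1)^-1 else f l.1) * y) 1 s.

Lemma word_value_cat s t : word_value (s ++ t) = word_value s * word_value t.
Proof. by elim: s => [|l s IHs] /=; rewrite ?mul1g // IHs mulgA. Qed.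

Lemma word_value_pres_eq (R : word X -> word X -> Prop) :
    (forall s t, R s t -> word_value s = word_value t) ->
  forall s t, pres_eq R s t -> word_value s = word_value t.
Proof.
move=> valR s t; elim=> {s t} // [s t u _ -> _ ->|s1 s2 t1 t2 _ E _ E'|x b] //.
  by rewrite !word_value_cat E E'.
by case: b; rewrite /= mulg1 ?mulVg ?mulgV.
Qed.

End WordValue.

(** The universal property of a presentation.  It holds because every rule
    generating [pres_eq], free cancellation included, preserves the value of a
    word in a group; the value is thus a function of the class of the word. *)
Lemma presented_lift (K : groupType) (X : choiceType)
    (R : word X -> word X -> Prop) (f : X -> K) :
    (forall s t, R s t -> word_value f s = word_value f t) ->
  exists r : {multiplicative presented R -> K},
    forall s, r (\pi_(presented R) s) = word_value f s.
Proof.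
move=> valR; pose r (x : presented R) := word_value f (repr x).
have r_pi s : r (\pi_(presented R) s) = word_value f s.
  exact: (word_value_pres_eq valR (repr_pi R s)).
have rM : {morph r : x y / x * y}.
  by move=> x y; rewrite [LHS]r_pi word_value_cat.
pose rmul := isMultiplicative.Build (presented R) K r rM.
by exists (HB.pack_for {multiplicative presented R -> K} r rmul).
Qed.

Lemma double_retraction (G G' : groupType) (phi : {multiplicative G -> G'})
    (n : nat) (H : 'I_n.+1 -> {pred G}) :
    bijective phi ->
  exists r : {multiplicative group_double phi H -> G},
    cancel (to_double phi H) r.
Proof.
case=> psi phiK psiK.
have psiM := can2_gmulfM phiK psiK.
pose f (x : double_gen G G' n) : G :=
  match x with inl (inl g) => g | inl (inr g') => psi g' | inr _ => 1 end.
have valR s t : double_rel phi H s t -> word_value f s = word_value f t.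
  by case=> /= *; rewrite ?mulg1 ?psiM ?phiK ?invg1 ?mul1g ?mulg1.
have [r r_pi] := presented_lift valR.
by exists r => x; rewrite /to_double r_pi /= mulg1.
Qed.

(** The equation [x ^ z = y] amounts to [x * z = z * y], in which only products
    occur. *)
Lemma multiplicative_conjugate (K L : groupType) (f : {multiplicative K -> L})
    (x y : K) :
  conjugate x y -> conjugate (f x) (f y).
Proof.
case=> z <-; exists (f z); apply: (mulgI (f z)).
by rewrite -conjgC -!gmulfM -conjgC.
Qed.

Theorem mainTheorem7 (G G' : groupType) (phi : {multiplicative G -> G'})
    (n : nat) (H : 'I_n.+1 -> {pred G})
    (phi_iso : bijective phi)
    (H_subgroup : forall i, group_closed (H i)) :
  injective (to_double phi H) /\
  (forall u v : G,
     conjugate (to_double phi H u) (to_double phi H v) <-> conjugate u v).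
Proof.
have [r toK] := double_retraction H phi_iso.
split=> [|u v]; first exact: can_inj toK.
split=> [/(multiplicative_conjugate r)|]; first by rewrite !toK.
exact: multiplicative_conjugate.
Qed.
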